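(* Let $1\le p<\infty$ and $W\in\mathbb{W}$, and let $\mathbf{1}_i=\mathbf{1}_{(i-1,i]}$ for $i\in\mathbb{N}$. Then for every $\epsilon>0$ the sequence $(\mathbf{1}_i)_{i=1}^\infty$ in $G_{W,p}(0,\infty)$ admits a normalized constant-coefficient block basic sequence, i.e. $x_j=\sum_{n=k_j}^{k_{j+1}-1}\mathbf{1}_n/\|\sum_{n=k_j}^{k_{j+1}-1}\mathbf{1}_n\|_G$ for some $1=k_1<k_2<\cdots$, which is $(1+\epsilon)$-equivalent to the unit vector basis of $\ell_p$ and whose closed linear span is 2-complemented in the closed linear span $[\mathbf{1}_i]_{i=1}^\infty$.
   Context: $\lambda$ is Lebesgue measure on $(0,\infty)$ with its usual order, $\Lambda$ the Lebesgue-measurable subsets. For $E,F\in\Lambda$, $\mathbb{MO}(E,F)$ is the set of strictly increasing bijections $m:E\to F$ with $m,m^{-1}$ measure-preserving. $\mathbb{W}$ is the set of nonincreasing measurable $W:(0,\infty)\to(0,\infty)$ with $\lim_{t\to\infty}W(t)=0$, $\int_0^\infty W=\infty$, $\int_0^1W<\infty$. $\|f\|_G=\sup\{(\int_E|f\circ m|(t)^pW(t)\,dt)^{1/p}:E,F\in\Lambda,\ m\in\mathbb{MO}(E,F)\}$ and $G_{W,p}(0,\infty)$ is the space of a.e.-classes of measurable $f$ with $\|f\|_G<\infty$. Sequences $(x_j)$, $(y_j)$ are $C$-equivalent if $C^{-1}\|\sum a_jy_j\|\le\|\sum a_jx_j\|\le C\|\sum a_jy_j\|$ for some such normalization with constant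 product $C$, for all finitely supported scalars. *)

(* Defs.v *)
From HB Require Import structures.
From mathcomp Require Import all_boot all_order all_algebra.
From mathcomp Require Import all_classical all_reals all_analysis.
Set Implicit Arguments. Unset Strict Implicit. Unset Printing Implicit Defensive.
Import Order.TTheory GRing.Theory Num.Theory.
Local Open Scope classical_set_scope.
Local Open Scope ring_scope.

(* The measurable space of Lebesgue-measurable subsets of R
   (the completed Lebesgue sigma-algebra; carrier R). *)
Definition LType (R : realType) :=
  caratheodory_type (R := R) (wlength (R := R) idfun)^*%mu.

Definition lam {R : realType} : set (LType R) -> \bar R :=
  @completed_lebesgue_measure R.

Definition Lmeasurable {R : realType} (A : set R) : Prop :=
  @measurable _ (LType R) A.

Definition pos {R : realType} : set R := `]0%R, +oo[%classic.

Definition Lambda {R : realType} (E : set R) : Prop :=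
  E `<=` pos /\ Lmeasurable E.

Definition MO {R : realType} (E F : set R) (m : R -> R) : Prop :=
  [/\ set_bij E F m,
      (forall x y, E x -> E y -> x < y -> m x < m y),
      (forall B, B `<=` F -> Lmeasurable B ->
         Lmeasurable (E `&` m @^-1` B) /\ lam (E `&` m @^-1` B) = lam B) &
      (* m^{-1} is measure preserving: preimages under m^{-1}, i.e.
         images under m, of measurable subsets of E *)
      (forall A, A `<=` E -> Lmeasurable A ->
         Lmeasurable (m @` A) /\ lam (m @` A) = lam A)].

Definition Wclass {R : realType} (W : R -> R) : Prop :=
  [/\ measurable_fun (pos : set (LType R)) (W : LType R -> R) /\
      (forall t, pos t -> 0 < W t),
      (forall s t, pos s -> s <= t -> W t <= W s),
      (W x @[x --> +oo%R] --> 0),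
      (\int[lam]_(t in (pos : set (LType R))) (W t)%:E = +oo)%E &
      (\int[lam]_(t in (`]0%R, 1%R]%classic : set (LType R))) (W t)%:E < +oo)%E].

(* ||f||_G = sup over E,F in Lambda, m in MO(E,F) of
   (int_E |f o m|^p W)^{1/p}; valued in \bar R.  Since x |-> x^{1/p} is
   increasing and continuous on [0,+oo], we take the 1/p power of the sup. *)
Definition Gnorm {R : realType} (W : R -> R) (p : R) (f : R -> R) : \bar R :=
  poweR (ereal_sup [set y | exists (E F : set R) (m : R -> R),
                     [/\ Lambda E, Lambda F, MO E F m &
                      y = (\int[lam]_(t in (E : set (LType R)))
                             ((`|f (m t)| `^ p * W t)%:E))%E]])
        p^-1.

Definition inG {R : realType} (W : R -> R) (p : R) (f : R -> R) : Prop :=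
  measurable_fun (pos : set (LType R)) (f : LType R -> R) /\
  (Gnorm W p f < +oo)%E.

Definition ind {R : realType} (i : nat) : R -> R :=
  \1_(`](i%:R - 1), i%:R]%classic).

Definition lincomb {R : realType} (x : nat -> R -> R) (N : nat) (a : nat -> R)
  : R -> R := fun t => \sum_(j < N) a j * x j t.

Definition cspan {R : realType} (W : R -> R) (p : R) (x : nat -> R -> R)
  (f : R -> R) : Prop :=
  inG W p f /\
  forall d : R, 0 < d -> exists (N : nat) (a : nat -> R),
    (Gnorm W p (fun t => (f t - lincomb x N a t)%R) < d%:E)%E.

Definition lp_norm {R : realType} (p : R) (N : nat) (a : nat -> R) : R :=
  (\sum_(j < N) `|a j| `^ p) `^ p^-1.

Definition equiv_lp {R : realType} (W : R -> R) (p C : R) (x : nat -> R -> R)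
  : Prop :=
  exists A B : R, [/\ 0 < A, 0 < B, A * B <= C &
    forall (N : nat) (a : nat -> R),
      ((A^-1 * lp_norm p N a)%:E <= Gnorm W p (lincomb x N a))%E /\
      (Gnorm W p (lincomb x N a) <= (B * lp_norm p N a)%:E)%E].

(* Y (closed subspace) is K-complemented in X: there is a linear projection
   P from X onto Y with ||P|| <= K.  Elements of G are a.e.-classes, so
   linearity and P|_Y = id are required up to a.e. equality on (0,oo). *)
Definition ae_eq {R : realType} (f g : R -> R) : Prop :=
  {ae lam, forall t : LType R, pos t -> f t = g t}.

Definition complemented {R : realType} (W : R -> R) (p K : R)
  (Y X : (R -> R) -> Prop) : Prop :=
  exists P : (R -> R) -> (R -> R),
    [/\ (forall f, X f -> Y (P f)),
        (forall f g (a b : R), X f -> X g ->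
           ae_eq (P (fun t => a * f t + b * g t))
                 (fun t => a * P f t + b * P g t)),
        (forall f, Y f -> ae_eq (P f) f) &
        (forall f, X f -> (Gnorm W p (P f) <= K%:E * Gnorm W p f)%E)].

Definition block {R : realType} (k : nat -> nat) (j : nat) : R -> R :=
  fun t => \sum_(k j <= n < k j.+1) ind n t.

Definition nblock {R : realType} (W : R -> R) (p : R) (k : nat -> nat)
  (j : nat) : R -> R :=
  fun t => block k j t / fine (Gnorm W p (block k j)).

(* Main.v *)
Require Import Defs.
From HB Require Import structures.
From mathcomp Require Import all_boot all_order all_algebra.
From mathcomp Require Import all_classical all_reals all_analysis.
From mathcomp Require Import measurable_realfun ring lra.
Set Implicit Arguments. Unset Strict Implicit. Unset Printing Implicit Defensive.
Import Order.TTheory GRing.Theory Num.Theory.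
Local Open Scope classical_set_scope.
Local Open Scope ring_scope.

(* Taking m = id in the supremum shows that the G-norm dominates the norm of
   L_p(W). Conversely, for a function constant on each of the consecutive
   blocks I_j = (s_j, s_{j+1}], the preimage of I_j under m has measure at most
   l_j = s_{j+1} - s_j, so it carries at most the W-mass of (0, l_j] because W
   is nonincreasing. Since W has infinite integral, the block lengths can be
   chosen inductively so that the W-mass of (0, l_j] is at most D times that of
   I_j, with D > 1 arbitrary. On functions constant on the blocks the p-th
   powers of the two norms therefore agree up to the factor D. In L_p(W) the
   normalized disjoint blocks span l_p isometrically, and W-averaging over the
   blocks is a contractive projection by Jensen's inequality; both facts
   transfer to the G-norm at the cost of powers of D. *)

(** * Elementary inequalities for real powers *)

Lemma powR_tangent {R : realType} (p x y : R) : 1 <= p -> 0 <= x -> 0 <= y ->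
  p * (x * y `^ (p - 1)) <= x `^ p + (p - 1) * y `^ p.
Proof.
rewrite le_eqVlt => /predU1P[<-|p1] x0 y0.
  by rewrite subrr powRr0 powRr1// mul0r addr0 mulr1 mul1r.
have p0 : 0 < p by rewrite (lt_trans _ p1).
have p10 : 0 < p - 1 by rewrite subr_gt0.
(* Young's inequality with conjugate exponents [p] and [p / (p - 1)]. Multiplied by [p], it says
   that the graph of the [p]-th power lies above its tangent at [y]. *)
have := @conjugate_powR R x (y `^ (p - 1)) p (p / (p - 1)) x0 (powR_ge0 _ _) p0.
have -> : y `^ (p - 1) `^ (p / (p - 1)) = y `^ p.
  by rewrite -powRrM mulrC divfK// gt_eqF.
have q0 : 0 < p / (p - 1) by rewrite divr_gt0.
move=> /(_ q0) H.
have /H{}H : p^-1 + (p / (p - 1))^-1 = 1 by field; rewrite !gt_eqF.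
rewrite -(ler_pM2l p0) in H; apply: (le_trans H).
rewrite mulrDr mulrC divfK ?gt_eqF// lerD2l.
by rewrite le_eqVlt; apply/orP; left; apply/eqP; field; rewrite !gt_eqF.
Qed.

(** The sum is at most twice the larger absolute value. The crude constant is harmless, since it
    will only multiply arbitrarily small errors. *)
Lemma powR_normD {R : realType} (p x y : R) : 0 <= p ->
  `|x + y| `^ p <= 2 `^ p * (`|x| `^ p + `|y| `^ p).
Proof.
move=> p0; wlog xy : x y / `|x| <= `|y|.
  move=> H; have [/H//|/ltW/H] := leP `|x| `|y|.
  by rewrite addrC [in leRHS]addrC.
rewrite (@le_trans _ _ ((2 * `|y|) `^ p))//.
  rewrite ge0_ler_powR ?nnegrE ?mulr_ge0//.
  by rewrite (le_trans (ler_normD _ _))// mulr_natl mulr2n lerD2r.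
by rewrite powRM// ler_pM2l ?powR_gt0// lerDr powR_ge0.
Qed.

(** * Weighted moments and block averages on a general measure space *)

Section weighted_averages.
Context d (T : measurableType d) (R : realType).
Variable mu : {measure set T -> \bar R}.
Variable W : T -> R.
Variable p : R.

(** The [p]-th power of the norm of L_p on [A] with density [W]; keeping the power avoids roots in
    the estimates. *)
Definition wmoment (A : set T) (f : T -> R) : \bar R :=
  (\int[mu]_(t in A) (`|f t| `^ p * W t)%:E)%E.

Definition waverage (A : set T) (f : T -> R) : R :=
  (\int[mu]_(t in A) (f t * W t)) / (\int[mu]_(t in A) W t).

(** Functions constant on each block take the form [c (block_index I t)] for a sequence [c]. Off the
    union of the blocks the index defaults to 0. *)
Definition block_index (I : nat -> set T) (t : T) : nat :=
  xget 0%N [set j | I j t].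

(** On the union of disjoint blocks, this is the conditional expectation given the partition, for
    the measure with density [W]. *)
Definition block_average (I : nat -> set T) (f : T -> R) : T -> R :=
  fun t => waverage (I (block_index I t)) f.

Lemma measurable_wmoment (A : set T) (f : T -> R) :
  measurable_fun A W -> measurable_fun A f ->
  measurable_fun A (fun t => `|f t| `^ p * W t).
Proof.
move=> mW mf; apply: measurable_funM => //.
have mn : measurable_fun A (Num.norm \o f) by exact: measurableT_comp.
exact: (measurableT_comp (measurable_powR p) mn).
Qed.

Section on_a_block.
Variable A : set T.
Hypotheses (mA : measurable A) (mW : measurable_fun A W).
Hypotheses (W0 : forall t, A t -> 0 < W t).
Hypotheses (iW : mu.-integrable A (EFin \o W)).
Hypothesis p1 : 1 <= p.
Implicit Types f g : T -> R.

Let p0 : 0 < p. Proof. exact: lt_le_trans p1. Qed.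

Lemma wmoment_ge0 f : (0 <= wmoment A f)%E.
Proof.
by apply: integral_ge0 => t At; rewrite lee_fin mulr_ge0 ?powR_ge0// ltW// W0.
Qed.

Lemma wmoment_integrable f : measurable_fun A f -> (wmoment A f < +oo)%E ->
  mu.-integrable A (EFin \o (fun t => `|f t| `^ p * W t)).
Proof.
move=> mf fi; apply/integrableP; split.
  exact/measurable_EFinP/measurable_wmoment.
apply: le_lt_trans fi; rewrite /wmoment le_eqVlt; apply/orP; left; apply/eqP.
apply: eq_integral => t; rewrite inE => At /=.
by rewrite ger0_norm// mulr_ge0 ?powR_ge0// ltW// W0.
Qed.

(** As [p] is at least 1, |f| is at most |f|^p + 1, and both |f|^p W and [W] are integrable on
    [A]. *)
Lemma weighted_integrable f : measurable_fun A f -> (wmoment A f < +oo)%E ->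
  mu.-integrable A (EFin \o (fun t => f t * W t)).
Proof.
move=> mf fi.

have := integrableD mA (wmoment_integrable mf fi) iW.
apply: le_integrable => //; first exact/measurable_EFinP/measurable_funM.
move=> t At /=; have Wt := ltW (W0 At).
rewrite lee_fin -[X in _ + X]mul1r normrM -mulrDl normrM (ger0_norm Wt) ler_wpM2r//.
rewrite [leRHS]ger0_norm ?addr_ge0 ?powR_ge0//.
have [f1|f1] := leP `|f t| 1; first by rewrite (le_trans f1)// lerDr powR_ge0.
by rewrite (le_trans (le1r_powR (ltW f1) p1))// lerDl.
Qed.

Lemma waverage_lin f g (a b : R) :
  measurable_fun A f -> (wmoment A f < +oo)%E ->
  measurable_fun A g -> (wmoment A g < +oo)%E ->
  waverage A (fun t => a * f t + b * g t) = a * waverage A f + b * waverage A g.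
Proof.
move=> mf fi mg gi; rewrite /waverage !mulrA -mulrDl; congr (_ / _).
rewrite -!RintegralZl//; [|exact: weighted_integrable..].
rewrite -RintegralD//; last 2 first.
- exact: (integrableZl mA a (weighted_integrable mf fi)).
- exact: (integrableZl mA b (weighted_integrable mg gi)).
by apply: eq_Rintegral => t _; rewrite mulrDl !mulrA.
Qed.

Lemma le_wmomentD f g : measurable_fun A f -> measurable_fun A g ->
  (wmoment A (fun t => (f t + g t)%R) <=
     (2 `^ p)%:E * (wmoment A f + wmoment A g))%E.
Proof.
move=> mf mg.
have mwf := measurable_wmoment mW mf; have mwg := measurable_wmoment mW mg.
have nn (h : T -> R) t : A t -> (0 <= (`|h t| `^ p * W t)%:E)%E.
  by move=> At; rewrite lee_fin mulr_ge0 ?powR_ge0// ltW// W0.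
rewrite /wmoment -ge0_integralD//; [|by move=> t /nn|exact/measurable_EFinP|
  by move=> t /nn|exact/measurable_EFinP].
have mwfg : measurable_fun A
    (fun t => ((`|f t| `^ p * W t)%:E + (`|g t| `^ p * W t)%:E)%E).
  by apply/measurable_EFinP; exact: measurable_funD mwf mwg.
rewrite -ge0_integralZl; last 4 first.
- exact: mA.
- exact: mwfg.
- by move=> t At; rewrite adde_ge0// nn.
- by rewrite lee_fin powR_ge0.
apply: ge0_le_integral => //.
- exact: nn.
- by apply/measurable_EFinP/measurable_wmoment => //; exact: measurable_funD.
- exact: measurable_funeM.
- move=> t At; rewrite -EFinD -EFinM lee_fin -mulrDl mulrA ler_wpM2r//.
    exact/ltW/W0.
  by rewrite powR_normD// ltW.
Qed.

Lemma wmoment_eq0_ae f : measurable_fun A f -> wmoment A f = 0%E ->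
  {ae mu, forall t, A t -> f t = 0}.
Proof.
move=> mf f0; have mwf := measurable_wmoment mW mf.
have : (\int[mu]_(t in A) `|(`|f t| `^ p * W t)%:E| = 0)%E.
  rewrite -f0; apply: eq_integral => t; rewrite inE => At.
  by rewrite gee0_abs// lee_fin mulr_ge0 ?powR_ge0// ltW// W0.
have /measurable_EFinP mwfE := mwf.
move=> /(ae_eq_integral_abs mu mA mwfE).1 [N [mN N0 sN]].
exists N; split => // t /= nft; apply: sN => /= ft.
apply: nft => At; have [] := ft At; move/eqP.
by rewrite mulf_eq0 (gt_eqF (W0 At)) orbF powR_eq0 => /andP[/eqP/normr0_eq0].
Qed.

Hypothesis m0 : 0 < \int[mu]_(t in A) W t.

Lemma waverage_cst f c : (forall t, A t -> f t = c) -> waverage A f = c.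
Proof.
move=> fc; rewrite /waverage (@eq_Rintegral _ _ _ _ _ (fun t => c * W t)).
  by rewrite RintegralZl// mulfK// gt_eqF.
by move=> t; rewrite inE => /fc ->.
Qed.

Lemma wmoment_cst f c : (forall t, A t -> f t = c) ->
  wmoment A f = (`|c| `^ p * \int[mu]_(t in A) W t)%:E.
Proof.
move=> fc; rewrite EFinM fineK; last exact: integrable_fin_num.
rewrite -ge0_integralZl; last 4 first.
- exact: mA.
- exact/measurable_EFinP.
- by move=> t /W0/ltW; rewrite lee_fin.
- by rewrite lee_fin powR_ge0.
by apply: eq_integral => t; rewrite inE => /fc ->.
Qed.

Lemma waverage_powR_le f : measurable_fun A f -> (wmoment A f < +oo)%E ->
  ((`|waverage A f| `^ p * \int[mu]_(t in A) W t)%:E <= wmoment A f)%E.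
Proof.
move=> mf fi; have ifp := wmoment_integrable mf fi.
have iaf := integrable_norm (weighted_integrable mf fi).
have m0' := m0; set m := \int[mu]_(t in A) W t; rewrite -/m in m0'.
(* Jensen: integrate [powR_tangent] at the weighted mean [y] of [`|f|]. *)
pose y := (\int[mu]_(t in A) `|f t * W t|) / m.
have y0 : 0 <= y by rewrite divr_ge0 ?(ltW m0')// Rintegral_ge0.
have avgy : `|waverage A f| <= y.
  rewrite normrM normfV (gtr0_norm m0') ler_pM2r ?invr_gt0//.
  by apply: le_normr_Rintegral => //; exact: weighted_integrable.
apply: (@le_trans _ _ (y `^ p * m)%:E).
  by rewrite lee_fin ler_pM2r// ge0_ler_powR ?nnegrE// ltW.
rewrite /wmoment -[leRHS]fineK; last exact: integrable_fin_num.
rewrite lee_fin.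
have : \int[mu]_(t in A) ((p * y `^ (p - 1)) * `|f t * W t|) <=
    \int[mu]_(t in A) (`|f t| `^ p * W t + (p - 1) * y `^ p * W t).
  apply: le_Rintegral => //; [exact: (integrableZl mA _ iaf)| |].
    exact: (integrableD mA ifp (integrableZl mA _ iW)).
  move=> t At; have Wt := W0 At.
  rewrite normrM (gtr0_norm Wt) mulrA -mulrDl ler_wpM2r ?(ltW Wt)//.
  by rewrite -mulrA [_ * `|f t|]mulrC powR_tangent.
rewrite RintegralZl// RintegralD//; last exact: (integrableZl mA _ iW).
rewrite RintegralZl// -/m.
have -> : \int[mu]_(t in A) `|f t * W t| = y * m by rewrite divfK// gt_eqF.
have yp : y * y `^ (p - 1) = y `^ p by rewrite mulr_powRB1.
(* The integrated tangent inequality becomes p y^p m <= moment + (p - 1) y^p m, which leaves y^p m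
   <= moment. *)
rewrite (_ : p * y `^ (p - 1) * (y * m) = p * y `^ p * m); last first.
  by rewrite -yp; ring.
by rewrite /Rintegral; lra.
Qed.

End on_a_block.

Section on_blocks.
Variable I : nat -> set T.
Local Notation D := (\bigcup_j I j).
Hypotheses (mI : forall j, measurable (I j)) (tI : trivIset setT I).
Hypotheses (mW : measurable_fun D W) (W0 : forall t, D t -> 0 < W t).
Hypotheses (iW : forall j, mu.-integrable (I j) (EFin \o W)).
Hypotheses (m0 : forall j, 0 < \int[mu]_(t in I j) W t).
Hypothesis p1 : 1 <= p.
Implicit Types (f g : T -> R) (c : nat -> R).

Lemma block_indexE j t : I j t -> block_index I t = j.
Proof.
move=> Ijt; rewrite /block_index; case: xgetP => [i -> /= Iit|/(_ j)//].
by apply: tI => //; exists t.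
Qed.

Let mWj j : measurable_fun (I j) W.
Proof. by move/(measurable_fun_bigcup _ mI) : mW. Qed.

Let W0j j t : I j t -> 0 < W t.
Proof. by move=> Ijt; apply: W0; exists j. Qed.

Lemma measurable_step c : measurable_fun D (fun t => c (block_index I t)).
Proof.
apply/(measurable_fun_bigcup _ mI) => j.
apply: (eq_measurable_fun (cst (c j))); last exact: measurable_cst.
by move=> t; rewrite inE => /block_indexE ->.
Qed.

Lemma wmoment_bigcup f : measurable_fun D f ->
  wmoment D f = (\sum_(j <oo) wmoment (I j) f)%E.
Proof.
move=> mf; rewrite /wmoment ge0_integral_bigcup//.
  exact/measurable_EFinP/measurable_wmoment.
by move=> t Dt; rewrite lee_fin mulr_ge0 ?powR_ge0// ltW// W0.
Qed.

Lemma wmoment_le_bigcup f j : measurable_fun D f ->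
  (wmoment (I j) f <= wmoment D f)%E.
Proof.
move=> mf; apply: ge0_subset_integral => //.
- exact: bigcupT_measurable.
- exact/measurable_EFinP/measurable_wmoment.
- by move=> t Dt; rewrite lee_fin mulr_ge0 ?powR_ge0// ltW// W0.
- exact: bigcup_sup.
Qed.

Lemma wmoment_step c : wmoment D (fun t => c (block_index I t)) =
  (\sum_(j <oo) (`|c j| `^ p * \int[mu]_(t in I j) W t)%:E)%E.
Proof.
rewrite wmoment_bigcup; last exact: measurable_step.
apply: eq_eseriesr => j _; apply: wmoment_cst => //; first exact: W0j.
by move=> t /block_indexE ->.
Qed.

(** Jensen's inequality on each block, summed over the blocks. *)
Lemma wmoment_block_average f : measurable_fun D f -> (wmoment D f < +oo)%E ->
  (wmoment D (block_average I f) <= wmoment D f)%E.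
Proof.
move=> mf fi; rewrite (wmoment_step (fun j => waverage (I j) f)).
rewrite [leRHS]wmoment_bigcup//; apply: lee_nneseries => j _.
  by move=> _; rewrite lee_fin mulr_ge0 ?powR_ge0// ltW.
apply: waverage_powR_le => //; first exact: W0j.
  by move/(measurable_fun_bigcup _ mI) : mf.
exact: le_lt_trans (wmoment_le_bigcup j mf) fi.
Qed.

Lemma block_average_step c t : D t ->
  block_average I (fun t => c (block_index I t)) t = c (block_index I t).
Proof.
move=> [j _ Ijt]; rewrite /block_average (block_indexE Ijt).
by apply: waverage_cst => // s /block_indexE ->.
Qed.

Lemma block_average_lin f g (a b : R) t : D t ->
  measurable_fun D f -> (wmoment D f < +oo)%E ->
  measurable_fun D g -> (wmoment D g < +oo)%E ->
  block_average I (fun t => a * f t + b * g t) t =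
  a * block_average I f t + b * block_average I g t.
Proof.
move=> [j _ Ijt] mf fi mg gi; rewrite /block_average (block_indexE Ijt).
apply: waverage_lin.
- exact: mI.
- exact: mWj.
- exact: W0j.
- exact: iW.
- exact: p1.
- by move/(measurable_fun_bigcup _ mI) : mf.
- exact: le_lt_trans (wmoment_le_bigcup j mf) fi.
- by move/(measurable_fun_bigcup _ mI) : mg.
- exact: le_lt_trans (wmoment_le_bigcup j mg) gi.
Qed.

End on_blocks.
End weighted_averages.

(** * Lebesgue measure on intervals *)

HB.instance Definition _ (R : realType) := Measure.on (@lam R).

Section lebesgue_intervals.
Context {R : realType}.

Lemma Lmeasurable_itv (i : interval R) : Lmeasurable [set` i].
Proof. by apply: sub_caratheodory; exact: measurable_itv. Qed.

Lemma lam_itvoc (a b : R) : a <= b -> lam (`]a, b]%classic : set R) = (b - a)%:E.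
Proof.
move=> ab; transitivity (lebesgue_measure (`]a, b]%classic : set R)) => //.
rewrite lebesgue_measure_itv /= lte_fin; case: ltgtP ab => // -> _.
by rewrite subrr.
Qed.

Lemma in_pos (x : R) : pos x = (0 < x) :> Prop.
Proof. by rewrite /pos /= in_itv/= andbT. Qed.

Lemma pos_itvoc (a b : R) : 0 <= a -> `]a, b]%classic `<=` (pos : set R).
Proof.
move=> a0 x; rewrite in_pos/= in_itv/= => /andP[ax _].
by rewrite (le_lt_trans a0).
Qed.

End lebesgue_intervals.

(** * Integrals of a nonincreasing weight *)

Section weight.
Context {R : realType}.
Variable W : R -> R.
Hypothesis WW : Wclass W.

Let mW : measurable_fun (pos : set (LType R)) (W : LType R -> R).
Proof. by case: WW => -[]. Qed.

Let W0 t : pos t -> 0 < W t.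
Proof. by case: WW => -[_ H] _ _ _ _; exact: H. Qed.

Let Wni s t : pos s -> s <= t -> W t <= W s.
Proof. by case: WW => _ H _ _ _; apply: H. Qed.

Let mWS (A : set R) : Lmeasurable A -> A `<=` pos ->
  measurable_fun (A : set (LType R)) (EFin \o W).
Proof.
move=> mA Apos; apply/measurable_EFinP; apply: measurable_funS mW => //.
exact: Lmeasurable_itv.
Qed.

Let We0 (A : set R) : A `<=` pos -> forall t, A t -> (0 <= (W t)%:E)%E.
Proof. by move=> Apos t /Apos/W0/ltW; rewrite lee_fin. Qed.

(* Bathtub principle: compare [W] with the constant [W l] on both sides of the
   symmetric difference of [A] and [`]0, l]]. *)
Lemma integral_le_initial (A : set R) (l : R) : 0 < l ->
  Lmeasurable A -> A `<=` pos -> (lam A <= l%:E)%E ->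
  (\int[lam]_(t in (A : set (LType R))) (W t)%:E <=
   \int[lam]_(t in (`]0%R, l]%classic : set (LType R))) (W t)%:E)%E.
Proof.
move=> l0 mA Apos Al.
pose B := `]0%R, l]%classic : set (LType R).
have mB : measurable B by exact: Lmeasurable_itv.
have Bpos : B `<=` pos by exact: pos_itvoc.
(* The common part of [A] and [B] has finite measure, so it cancels from the comparison of [lam A]
   with [lam B]. *)
have ABl : (lam (A `\` B) <= lam (B `\` A))%E.
  have lamB : lam B = l%:E by rewrite lam_itvoc ?subr0// ltW.
  have fAB : lam (A `&` B) \is a fin_num.
    rewrite ge0_fin_numE//; apply: (@le_lt_trans _ _ (lam A)).
      exact: measureIl.
    exact: le_lt_trans Al (ltry _).
  have := Al; rewrite -lamB (measureDI lam mA mB) (measureDI lam mB mA).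
  by rewrite (setIC B A) leeD2rE.
have mAB : measurable (A `\` B : set (LType R)) by exact: measurableD.
have mBA : measurable (B `\` A : set (LType R)) by exact: measurableD.
have mAiB : measurable (A `&` B : set (LType R)) by exact: measurableI.
have ABpos : A `\` B `<=` pos by move=> t [/Apos].
have BApos : B `\` A `<=` pos by move=> t [/Bpos].
have lpos : pos l by rewrite in_pos.
rewrite -[X in (integral _ X _ <= _)%E](setUIDK A B).
rewrite -[X in (_ <= integral _ X _)%E](setUIDK B A).
rewrite ge0_integral_setU; last 5 first.
- exact: mAiB.
- exact: mAB.
- by rewrite setUIDK; exact: mWS.
- by rewrite setUIDK; exact: We0.
- by rewrite disj_set2E; apply/eqP/seteqP; split => t //= [[? ?] [? ?]].
rewrite ge0_integral_setU; last 5 first.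
- exact: measurableI mB mA.
- exact: mBA.
- by rewrite setUIDK; exact: mWS.
- by rewrite setUIDK; exact: We0.
- by rewrite disj_set2E; apply/eqP/seteqP; split => t //= [[? ?] [? ?]].
rewrite (setIC B A); apply: leeD2l.
apply: (@le_trans _ _ ((W l)%:E * lam (A `\` B))%E).
  rewrite -integral_cst; last exact: mAB.
  apply: ge0_le_integral; first exact: mAB.
  - exact: We0.
  - exact: mWS.
  - exact: measurable_cst.
  - move=> t [At]; rewrite /B /= in_itv/= => /negP; rewrite negb_and.
    move: (Apos _ At); rewrite in_pos => -> /=.
    by rewrite -ltNge lee_fin => /ltW lt; exact: Wni.
apply: (@le_trans _ _ ((W l)%:E * lam (B `\` A))%E).
  by rewrite lee_wpmul2l// lee_fin ltW// W0.
rewrite -integral_cst; last exact: mBA.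
apply: ge0_le_integral; first exact: mBA.
- by move=> t _; rewrite lee_fin ltW// W0.
- exact: measurable_cst.
- exact: mWS.
- move=> t [Bt _]; rewrite lee_fin; apply: Wni; first exact: Bpos.
  by move: Bt; rewrite /B/= in_itv/= => /andP[].
Qed.

(** Up to 1 the integral is finite by [Wclass]; beyond 1 the weight is bounded by [W 1]. *)
Lemma initial_integral_lty (b : R) :
  (\int[lam]_(t in (`]0%R, b]%classic : set (LType R))) (W t)%:E < +oo)%E.
Proof.
have W1 : pos (1 : R) by rewrite in_pos ltr01.
case: WW => _ _ _ _ WI.
pose U : set (LType R) := `]0, 1]%classic `|` `]1, b]%classic.
have sub : `]0, b]%classic `<=` U.
  move=> t; rewrite /U /= !in_itv/= => /andP[t0 tb].
  by have [t1|t1] := leP t 1; [left|right]; rewrite ?t0 ?tb.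
have mU : measurable U by apply: measurableU; exact: Lmeasurable_itv.
have Upos : U `<=` pos by move=> t [|]; apply: pos_itvoc.
apply: (@le_lt_trans _ _ (\int[lam]_(t in U) (W t)%:E)%E).
  apply: ge0_subset_integral;
    [exact: Lmeasurable_itv|exact: mU|exact: mWS|exact: We0|exact: sub].
rewrite ge0_integral_setU; [|exact: Lmeasurable_itv..|exact: mWS|exact: We0|].
  apply: lte_add_pinfty; first exact: WI.
  have m1 : measurable (`]1, b]%classic : set (LType R)).
    exact: Lmeasurable_itv.
  have p1 : `]1, b]%classic `<=` (pos : set R) by exact: pos_itvoc.
  apply: (@le_lt_trans _ _ ((W 1%R)%:E * lam (`]1%R, b]%classic : set (LType R)))%E).
    rewrite -integral_cst; last exact: m1.
    apply: ge0_le_integral; first exact: m1.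
    - exact: We0.
    - exact: mWS.
    - exact: measurable_cst.
    - move=> t; rewrite /= in_itv/= => /andP[/ltW t1 _].
      by rewrite lee_fin; exact: Wni.
  have [b1|b1] := leP 1 b; first by rewrite lam_itvoc// -EFinM ltry.
  by rewrite set_itv_ge ?measure0 ?mule0// bnd_simp -leNgt ltW.
rewrite disj_set2E; apply/eqP/seteqP; split => t //=; rewrite !in_itv/=.
by move=> [/andP[_ t1] /andP[/lt_geF]]; rewrite t1.
Qed.

Lemma itv_weight_integrable (a b : R) : 0 <= a ->
  lam.-integrable (`]a, b]%classic : set (LType R)) (EFin \o W).
Proof.
move=> a0; have p0 : `]a, b]%classic `<=` pos := pos_itvoc a0.
have m0 : measurable (`]a, b]%classic : set (LType R)) by exact: Lmeasurable_itv.
apply/integrableP; split; first exact: mWS.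
apply: le_lt_trans (initial_integral_lty b).
rewrite (eq_integral (fun t : LType R => (W t)%:E)); last first.
  by move=> t; rewrite inE => /p0/W0 Wt; rewrite /= ger0_norm// ltW.
apply: ge0_subset_integral; [exact: m0|exact: Lmeasurable_itv| | |].
- by apply: mWS; [exact: Lmeasurable_itv|exact: pos_itvoc].
- by apply: We0; exact: pos_itvoc.
- move=> t /=; rewrite !in_itv/= => /andP[t1 ->].
  by rewrite (le_lt_trans a0).
Qed.

(** Monotone convergence along the intervals []0, n]], which exhaust the half-line, where [W] has
    infinite integral. *)
Lemma initial_integral_unbounded (M : R) : exists2 l : nat, (0 < l)%N &
  (M%:E <= \int[lam]_(t in (`]0%R, l%:R]%classic : set (LType R))) (W t)%:E)%E.
Proof.
pose F (n : nat) := `]0%R, n%:R]%classic : set (LType R).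
have mF n : measurable (F n) by exact: Lmeasurable_itv.
have ndF : nondecreasing_seq F.
  move=> m n mn; apply/subsetPset => t; rewrite /F/= !in_itv/= => /andP[-> tm].
  by rewrite (le_trans tm)// ler_nat.
have := @ge0_nondecreasing_set_cvg_integral _ _ _ F (EFin \o W) lam ndF mF.
have Fpos n : F n `<=` pos by exact: pos_itvoc.
move=> /(_ (fun n => mWS (mF n) (@Fpos n)) (fun n => We0 (@Fpos n))).
have -> : \bigcup_i F i = pos.
  apply/seteqP; split => [t [n _ /Fpos]//|t].
  rewrite in_pos => t0; exists (Num.truncn t).+1 => //.
  by rewrite /F/= in_itv/= t0 ltW// truncnS_gt.
case: WW => _ _ _ /= -> _ /cvgeyPge/(_ M) [N _ HN].
exists N.+1 => //; apply: HN => /=; exact: leqnSn.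
Qed.

(** Let a be the mass of []0, s]] and b that of []s, s + l]]. The mass of []0, l]] is at most a + b,
    so a <= (D - 1) b is enough, and this holds for large [l] because b grows without bound. *)
Lemma late_interval_dominates (D : R) (s : nat) : 1 < D ->
  exists2 l : nat, (0 < l)%N &
  (\int[lam]_(t in (`]0%R, l%:R]%classic : set (LType R))) (W t)%:E <=
   D%:E * \int[lam]_(t in (`]s%:R, (s + l)%:R]%classic : set (LType R)))
            (W t)%:E)%E.
Proof.
move=> D1; have D10 : 0 < D - 1 by rewrite subr_gt0.
pose J a b := \int[lam]_(t in (`]a, b]%classic : set (LType R))) W t.
have JE a b : 0 <= a ->
    (\int[lam]_(t in (`]a, b]%classic : set (LType R))) (W t)%:E = (J a b)%:E)%E.
  move=> a0; rewrite fineK//; apply: integrable_fin_num.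
    exact: Lmeasurable_itv.
  exact: itv_weight_integrable.
(* Once the mass of []0, s]] is subtracted, this threshold leaves at least [J 0 s%:R / (D - 1)] on
   the late interval. *)
have [l l0 Hl] := initial_integral_unbounded (J 0 s%:R + J 0 s%:R / (D - 1)).
exists l => //.
have mono : J 0 l%:R <= J 0 (s + l)%:R.
  rewrite -lee_fin -!JE//; apply: ge0_subset_integral;
    [exact: Lmeasurable_itv..| | |].
  - by apply: mWS; [exact: Lmeasurable_itv|exact: pos_itvoc].
  - by apply: We0; exact: pos_itvoc.
  - move=> t /=; rewrite !in_itv/= => /andP[-> tl].
    by rewrite (le_trans tl)// ler_nat leq_addl.
have chasles : J 0 (s + l)%:R = J 0 s%:R + J s%:R (s + l)%:R.
  apply: EFin_inj; rewrite EFinD -!JE//.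
  have -> : `]0, (s + l)%:R]%classic =
      (`]0, s%:R]%classic `|` `]s%:R, (s + l)%:R]%classic : set R).
    apply/seteqP; split => t /=; rewrite !in_itv/=.
      move=> /andP[t0 tl]; have [ts|ts] := leP t s%:R; [left|right].
        by rewrite t0.
      by rewrite tl.
    move=> [/andP[-> ts]|/andP[st ->]].
      by rewrite (le_trans ts)// ler_nat leq_addr.
    by rewrite (le_lt_trans _ st).
  rewrite ge0_integral_setU; [|exact: Lmeasurable_itv..| | |]; first by [].
  - apply: mWS; first by apply: measurableU; exact: Lmeasurable_itv.
    by move=> t [|]; apply: pos_itvoc.
  - by apply: We0 => t [|]; apply: pos_itvoc.
  - rewrite disj_set2E; apply/eqP/seteqP; split => t //=; rewrite !in_itv/=.
    by move=> [/andP[_ t1] /andP[/lt_geF]]; rewrite t1.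
rewrite !JE// -EFinM lee_fin; rewrite JE// lee_fin in Hl.
have : J 0 s%:R <= (D - 1) * J s%:R (s + l)%:R.
  rewrite -ler_pdivrMl// mulrC.
  have : J 0 l%:R <= J 0 s%:R + J s%:R (s + l)%:R by rewrite -chasles.
  by lra.
by move: mono; rewrite chasles; lra.
Qed.

End weight.

(** * The G-norm through its [p]-th power *)

Section norm_power.
Context {R : realType}.
Variables (W : R -> R) (p : R).
Implicit Types (f g : R -> R) (c : R).

(** The supremum under the root in [Gnorm]. Estimates are proved for it and carried to the norm by
    the lemmas of this section. *)
Definition Gsup f : \bar R :=
  ereal_sup [set y | exists (E F : set R) (m : R -> R),
    [/\ Lambda E, Lambda F, MO E F m &
        y = (\int[lam]_(t in (E : set (LType R)))
               ((`|f (m t)| `^ p * W t)%:E))%E]].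

Lemma GnormE f : Gnorm W p f = (Gsup f `^ p^-1)%E.
Proof. by []. Qed.

(** An admissible [m] takes its values on [E] in [F], hence in [pos], so values elsewhere never
    enter. *)
Lemma eq_Gsup f g : (forall t, pos t -> f t = g t) -> Gsup f = Gsup g.
Proof.
have le_Gsup h1 h2 : (forall t, pos t -> h1 t = h2 t) ->
    (Gsup h1 <= Gsup h2)%E.
  move=> h12; apply: ge_ereal_sup => _ [E [F [m [LE LF Em ->]]]].
  have mEpos t : E t -> pos (m t).
    by move=> Et; case: LF Em => Fpos _ [[mEF _ _] _ _ _]; exact/Fpos/mEF.
  apply: ereal_sup_ubound; exists E, F, m.
  split; [exact: LE|exact: LF|exact: Em|].
  by apply: eq_integral => t; rewrite inE => /mEpos/h12 ->.
move=> fg; apply: le_anti; apply/andP; split; apply: le_Gsup => t pt.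
  exact: fg.
by rewrite fg.
Qed.

Lemma MO_id : MO (pos : set R) pos id.
Proof.
split => //; first by split => // t pt; exists t.
- move=> B Bpos mB; suff -> : pos `&` id @^-1` B = B by [].
  by apply/seteqP; split => [t []//|t Bt]; split => //; exact: Bpos.
- by move=> A Apos mA; rewrite image_id.
Qed.

Lemma wmoment_le_Gsup f : (wmoment lam W p (pos : set (LType R)) f <= Gsup f)%E.
Proof.
apply: ereal_sup_ubound; exists pos, pos, id.
have Lpos : Lambda (pos : set R) by split => //; exact: Lmeasurable_itv.
by split => //; exact: MO_id.
Qed.

Hypothesis p0 : 0 < p.

Let pN0 : p != 0. Proof. by rewrite gt_eqF. Qed.
Let pV0 : 0 <= p^-1. Proof. by rewrite invr_ge0 ltW. Qed.

Lemma powRVK c : 0 <= c -> (c `^ p) `^ p^-1 = c.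
Proof. by move=> c0; rewrite -powRrM mulfV// powRr1. Qed.

Lemma powRKV c : 0 <= c -> (c `^ p^-1) `^ p = c.
Proof. by move=> c0; rewrite -powRrM mulVf// powRr1. Qed.

Lemma Gnorm_lty f : (Gnorm W p f < +oo)%E = (Gsup f < +oo)%E.
Proof.
rewrite GnormE; apply/idP/idP; last exact: poweR_lty.
by apply: contraTT; rewrite -!leNgt !leye_eq => /eqP->; rewrite poweRyr ?invr_eq0.
Qed.

Hypothesis W0 : forall t, pos t -> 0 < W t.

Lemma wmoment_nonneg f : (0 <= wmoment lam W p (pos : set (LType R)) f)%E.
Proof. by apply: wmoment_ge0 => t; exact: W0. Qed.

Lemma Gsup_ge0 f : (0 <= Gsup f)%E.
Proof. exact: le_trans (wmoment_nonneg f) (wmoment_le_Gsup f). Qed.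

Let poweR_homo (x y : \bar R) : (0 <= x)%E -> (x <= y)%E ->
  (x `^ p^-1 <= y `^ p^-1)%E.
Proof.
move=> x0 xy; apply: gt0_ler_poweR => //; rewrite in_itv/= ?leey ?andbT//.
exact: le_trans xy.
Qed.

Lemma Gnorm_le_mul f g c : 0 <= c -> (Gsup g <= (c `^ p)%:E * Gsup f)%E ->
  (Gnorm W p g <= c%:E * Gnorm W p f)%E.
Proof.
move=> c0 H; rewrite !GnormE -[in leRHS](powRVK c0) -poweR_EFin -poweRM//.
- by apply: poweR_homo => //; exact: Gsup_ge0.
- by rewrite lee_fin powR_ge0.
- exact: Gsup_ge0.
Qed.

Lemma Gnorm_le f c : 0 <= c -> (Gsup f <= (c `^ p)%:E)%E ->
  (Gnorm W p f <= c%:E)%E.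
Proof.
move=> c0 H; rewrite GnormE -[in leRHS](powRVK c0) -poweR_EFin.
by apply: poweR_homo => //; exact: Gsup_ge0.
Qed.

Lemma Gnorm_ge f c : 0 <= c -> ((c `^ p)%:E <= Gsup f)%E ->
  (c%:E <= Gnorm W p f)%E.
Proof.
move=> c0 H; rewrite GnormE -[in leLHS](powRVK c0) -poweR_EFin poweR_homo//.
by rewrite lee_fin powR_ge0.
Qed.

Lemma Gsup_lt f c : 0 <= c -> (Gnorm W p f < c%:E)%E ->
  (Gsup f < (c `^ p)%:E)%E.
Proof. by move=> c0; apply: contraTT; rewrite -!leNgt; exact: Gnorm_ge. Qed.

Lemma Gnorm_lt f c : 0 < c -> (Gsup f < (c `^ p)%:E)%E ->
  (Gnorm W p f < c%:E)%E.
Proof.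
move=> c0 H; have fin : Gsup f \is a fin_num.
  by rewrite ge0_fin_numE; [exact: lt_trans H (ltry _)|exact: Gsup_ge0].
rewrite GnormE -(fineK fin) poweR_EFin lte_fin -[ltRHS](powRVK (ltW c0)).
rewrite gt0_ltr_powR ?invr_gt0 ?nnegrE ?powR_ge0 ?fine_ge0 ?Gsup_ge0//.
by rewrite -lte_fin fineK.
Qed.

End norm_power.

(** The supports []i - 1, i]] are adjacent. Positivity of [m] makes [m.-1] the true difference m -
    1. *)
Lemma sum_ind {R : realType} (m n : nat) (t : R) : (0 < m <= n)%N ->
  \sum_(m <= i < n) ind i t = \1_(`]m.-1%:R, n.-1%:R]%classic) t.
Proof.
move=> /andP[m0]; elim: n => [|n IH]; first by rewrite leqNgt m0.
rewrite leq_eqVlt => /predU1P[<-|].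
  by rewrite big_geq// set_itv_ge ?indic0// bnd_simp ltxx.
rewrite ltnS => mn; rewrite big_nat_recr//= IH// /ind !indicE.
have n0 : (0 < n)%N by rewrite (leq_trans m0).
have mnR : m.-1%:R <= n.-1%:R :> R.
  by rewrite ler_nat; case: (m) (n) mn m0 n0 => [//|a] [].
have -> : n%:R - 1 = n.-1%:R :> R by rewrite -subn1 natrB.
rewrite -natrD; congr (_%:R).
have nnR : n.-1%:R <= n%:R :> R by rewrite ler_nat leq_pred.
rewrite !mem_setE !in_itv/=; case: (ltP n.-1%:R t) => nt /=.
  by rewrite andbF add0n (le_lt_trans mnR).
by rewrite addn0 (le_trans nt nnR).
Qed.

(** * Consecutive blocks with integer endpoints *)

Section consecutive_blocks.
Context {R : realType}.
Variables (W : R -> R) (p : R).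
Hypotheses (WW : Wclass W) (p1 : 1 <= p).
Variable s : nat -> nat.
Hypotheses (s0 : s 0%N = 0%N) (sS : forall j, (s j < s j.+1)%N).

Definition blk (j : nat) : set (LType R) := `](s j)%:R, (s j.+1)%:R]%classic.

Local Notation blkW j := (\int[lam]_(t in blk j) W t).
Local Notation idx := (block_index blk).

Let p0 : 0 < p. Proof. exact: lt_le_trans p1. Qed.

Let W0 t : pos t -> 0 < W t.
Proof. by case: WW => -[_ H] _ _ _ _; exact: H. Qed.

Let smono i j : (i <= j)%N -> (s i <= s j)%N.
Proof.
move: i j; apply: (homo_leq (r := leq) (f := s)) => [//|y x z|n].
  exact: leq_trans.
exact: ltnW.
Qed.

Lemma measurable_blk j : measurable (blk j).
Proof. exact: Lmeasurable_itv. Qed.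

Lemma trivIset_blk : trivIset setT blk.
Proof.
apply/trivIsetP => i j _ _; wlog ij : i j / (i < j)%N.
  by move=> H; rewrite neq_ltn => /orP[ij|ji];
    [|rewrite setIC]; apply: H => //; rewrite neq_ltn ?ij ?ji.
move=> _; apply/seteqP; split => t //=; rewrite /blk/= !in_itv/=.
move=> [/andP[_ ti] /andP[jt _]]; have : (s i.+1)%:R <= (s j)%:R :> R.
  by rewrite ler_nat smono.
by move=> /(le_trans ti)/(lt_le_trans jt); rewrite ltxx.
Qed.

(** The endpoints start at 0 and are unbounded, being strictly increasing integers. *)
Lemma bigcup_blk : \bigcup_j blk j = pos.
Proof.
apply/seteqP; split => [t [j _]|t].
  by apply: pos_itvoc.
rewrite in_pos => t0.
have [N tN] : exists N, t <= (s N)%:R.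
  exists (Num.truncn t).+1; apply: (@le_trans _ _ (Num.truncn t).+1%:R).
    by rewrite ltW// truncnS_gt.
  rewrite ler_nat; elim: (Num.truncn t).+1 => // n IH.
  exact: leq_ltn_trans IH (sS n).
elim: N tN => [|N IH tN]; first by rewrite s0 leNgt t0.
have [/IH//|Nt] := leP t (s N)%:R.
by exists N => //; rewrite /blk/= in_itv/= Nt.
Qed.

Lemma blk_pos j : blk j `<=` pos.
Proof. by rewrite -bigcup_blk; exact: bigcup_sup. Qed.

Lemma measurable_weight : measurable_fun (\bigcup_j blk j) (W : LType R -> R).
Proof. by rewrite bigcup_blk; case: WW => -[]. Qed.

Lemma blk_weight_gt0 t : (\bigcup_j blk j) t -> 0 < W t.
Proof. by rewrite bigcup_blk; exact: W0. Qed.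

Lemma blk_integrable j : lam.-integrable (blk j) (EFin \o W).
Proof. exact: itv_weight_integrable. Qed.

Lemma blkW_fin_num j :
  (\int[lam]_(t in blk j) (W t)%:E)%E \is a fin_num.
Proof.
by apply: integrable_fin_num; [exact: measurable_blk|exact: blk_integrable].
Qed.

(** On a block [W] is at least its value at the right endpoint, which is positive. *)
Lemma blkW_gt0 j : 0 < blkW j.
Proof.
have b0 : (pos : set R) (s j.+1)%:R by rewrite in_pos ltr0n (leq_ltn_trans _ (sS j)).
rewrite -lte_fin fineK; last exact: blkW_fin_num.
apply: (@lt_le_trans _ _ ((W (s j.+1)%:R)%:E * lam (blk j))%E).
  rewrite mule_gt0 ?lte_fin ?W0// lam_itvoc ?lte_fin ?subr_gt0 ?ltr_nat//.
  by rewrite ler_nat ltnW.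
rewrite -integral_cst; last exact: measurable_blk.
apply: ge0_le_integral; first exact: measurable_blk.
- by move=> t _; rewrite lee_fin ltW// W0.
- exact: measurable_cst.
- exact: (measurable_int lam (blk_integrable j)).
- move=> t bt; rewrite lee_fin; case: WW => _ H _ _ _; apply: H.
    exact: (@blk_pos j).
  by move: bt; rewrite /blk/= in_itv/= => /andP[].
Qed.

Lemma wmoment_blk_step (c : nat -> R) :
  wmoment lam W p pos (fun t : LType R => c (idx t)) =
  (\sum_(j <oo) (`|c j| `^ p * blkW j)%:E)%E.
Proof.
rewrite -bigcup_blk; apply: wmoment_step => //.
- exact: measurable_blk.
- exact: trivIset_blk.
- exact: measurable_weight.
- exact: blk_weight_gt0.
- exact: blk_integrable.
Qed.

(** * Blocks with dominated initial mass: equivalence with l_p and the averaging projection *)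

Variable D : R.
Hypothesis D1 : 1 <= D.
Hypothesis dom : forall j,
  (\int[lam]_(t in (`]0%R, (s j.+1 - s j)%:R]%classic : set (LType R))) (W t)%:E
   <= D%:E * \int[lam]_(t in blk j) (W t)%:E)%E.

(** Each preimage [A j] of a block is no longer than the block, so [integral_le_initial] followed by
    [dom] bounds its weight by [D] times that of [blk j]. Summing against |c j|^p gives the claim
    for every admissible [m]. *)
Lemma Gsup_step_le (c : nat -> R) :
  (Gsup W p (fun t => c (idx t)) <=
   D%:E * wmoment lam W p pos (fun t : LType R => c (idx t)))%E.
Proof.
apply: ge_ereal_sup => _ [E [F [m [[Epos mE] [Fpos mF] [bij _ pre _] ->]]]].
have [mEF _ _] := bij.
(* [MO] controls preimages of subsets of [F] only, hence the intersection with [F]. *)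
pose A j : set (LType R) := E `&` m @^-1` (F `&` blk j).
have mA j : measurable (A j) /\ lam (A j) = lam (F `&` blk j).
  apply: pre; first exact: subIsetl.
  exact: (measurableI _ _ mF (measurable_blk j)).
have EA : \bigcup_j A j = E.
  apply/seteqP; split => [t [j _ []]//|t Et].
  have : (\bigcup_j blk j) (m t) by rewrite bigcup_blk; apply/Fpos/mEF.
  by move=> [j _ mt]; exists j => //; split => //; split => //; exact: mEF.
have Apos j : A j `<=` pos by move=> t [/Epos].
have mWA j : measurable_fun (A j) (EFin \o W).
  apply/measurable_EFinP; case: WW => -[mW _] _ _ _ _.
  by apply: measurable_funS mW; [exact: Lmeasurable_itv|exact: Apos].
have cA j t : A j t -> c (idx (m t)) = c j.
  by move=> [_ [_ /(block_indexE trivIset_blk) ->]].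
rewrite -[X in (integral _ X _ <= _)%E]EA ge0_integral_bigcup; last 4 first.
- by move=> j; exact: (mA j).1.
(* On each [A j] the integrand is a constant multiple of [W], so it is measurable piece by piece. *)
- apply/(measurable_fun_bigcup _ (fun j => (mA j).1)) => j.
  apply: (eq_measurable_fun (fun t : LType R => ((`|c j| `^ p)%:E * (W t)%:E)%E)).
    by move=> t; rewrite inE => /cA ->.
  exact: measurable_funeM.
- by rewrite EA => t /Epos/W0/ltW Wt; rewrite lee_fin mulr_ge0// powR_ge0.
- apply/trivIsetP => i j _ _ ij; apply/seteqP; split => t //=.
  move=> [[_ [_ ti]] [_ [_ tj]]]; have /trivIsetP := trivIset_blk.
  by move=> /(_ i j I I ij)/seteqP[+ _]; apply; split; [exact: ti|exact: tj].
rewrite wmoment_blk_step.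
rewrite -nneseriesZl; last first.
  by move=> j _; rewrite lee_fin mulr_ge0 ?powR_ge0// ltW// blkW_gt0.
apply: lee_nneseries => j _.
  move=> _; apply: integral_ge0 => t /Apos/W0/ltW Wt.
  by rewrite lee_fin mulr_ge0// powR_ge0.
rewrite (eq_integral
  (fun t : LType R => ((`|c j| `^ p)%:E * (W t)%:E)%E)); last first.
  by move=> t; rewrite inE => /cA ->.
rewrite ge0_integralZl ?lee_fin ?powR_ge0//; last 2 first.
- exact: (mA j).1.
- by move=> t /Apos/W0/ltW Wt; rewrite lee_fin.
rewrite [in leRHS]EFinM muleCA lee_wpmul2l ?lee_fin ?powR_ge0//.
rewrite fineK; last exact: blkW_fin_num.
apply: le_trans (dom j); apply: integral_le_initial => //.
- by rewrite ltr0n subn_gt0.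
- exact: (mA j).1.
- rewrite (mA j).2; apply: (@le_trans _ _ (lam (blk j))).
    by rewrite measureIr//; exact: measurable_blk.
  by rewrite lam_itvoc ?ler_nat ?(ltnW (sS j))// natrB// ltnW.
Qed.

(** The function [ind i] lives on []i - 1, i]], so the indices from [s j + 1] to [s j.+1] fill
    exactly [blk j]; hence the shift by one. *)
Local Notation k := (fun j => (s j).+1).
Local Notation nrm j := (fine (Gnorm W p (block k j))).
Local Notation P := (block_average lam W blk).
Implicit Types (f g : LType R -> R) (c a : nat -> R).

Lemma measurable_blk_step c :
  measurable_fun (pos : set (LType R)) (fun t : LType R => c (idx t)).
Proof.
rewrite -bigcup_blk; apply: measurable_step; first exact: measurable_blk.
exact: trivIset_blk.
Qed.

Lemma pos_blk t : pos t -> exists j, blk j t.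
Proof. by rewrite -bigcup_blk => -[j _ jt]; exists j. Qed.

Lemma block_step j t : pos t -> block k j t = (idx t == j)%:R.
Proof.
move=> /pos_blk[i it]; rewrite /block sum_ind ?ltnS ?(ltnW (sS j))//=.
rewrite (block_indexE trivIset_blk it) indicE; congr (nat_of_bool _)%:R.
apply/idP/eqP => [|<-]; last by rewrite inE.
rewrite inE => jt; apply: (trivIset_blk (i := i) (j := j)) => //.
by exists t.
Qed.

Lemma wmoment_blk_step_fin N c : (forall j, (N <= j)%N -> c j = 0) ->
  wmoment lam W p pos (fun t : LType R => c (idx t)) =
  (\sum_(j < N) `|c j| `^ p * blkW j)%:E.
Proof.
move=> cN; rewrite wmoment_blk_step (nneseries_split 0 N); last first.
  by move=> j _; rewrite lee_fin mulr_ge0 ?powR_ge0// ltW// blkW_gt0.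
rewrite add0n eseries0 ?adde0; last first.
  by move=> j Nj _; rewrite cN// normr0 powR0 ?mul0r// gt_eqF.
by rewrite big_mkord sumEFin.
Qed.

Lemma Gsup_block_bounds j :
  ((blkW j)%:E <= Gsup W p (block k j) <= (D * blkW j)%:E)%E.
Proof.
pose c i : R := (i == j)%:R.
have -> : Gsup W p (block k j) = Gsup W p (fun t => c (idx t)).
  by apply: eq_Gsup => t pt; rewrite block_step.
have wE : wmoment lam W p pos (fun t : LType R => c (idx t)) = (blkW j)%:E.
  rewrite (@wmoment_blk_step_fin j.+1) => [|i ji]; last first.
    by rewrite /c gtn_eqF.
  rewrite big_ord_recr/= big1 => [|i _]; last first.
    by rewrite /c ltn_eqF// normr0 powR0 ?mul0r// gt_eqF.
  by rewrite add0r /c eqxx normr1 powR1 mul1r.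
by rewrite EFinM -wE wmoment_le_Gsup Gsup_step_le.
Qed.

Lemma nrm_bounds j : blkW j <= nrm j `^ p <= D * blkW j.
Proof.
have /andP[lo hi] := Gsup_block_bounds j.
have fin : Gsup W p (block k j) \is a fin_num.
  by rewrite ge0_fin_numE; [exact: le_lt_trans hi (ltry _)|exact: Gsup_ge0].
rewrite GnormE -(fineK fin) poweR_EFin/= powRKV//; last first.
  by rewrite fine_ge0//; exact: Gsup_ge0.
by apply/andP; split; rewrite -lee_fin (fineK fin).
Qed.

Lemma nrm_gt0 j : 0 < nrm j.
Proof.
have /andP[lo _] := nrm_bounds j.
rewrite lt_neqAle fine_ge0 ?poweR_ge0// andbT; apply/negP => /eqP n0.
by move: lo; rewrite -n0 powR0 ?gt_eqF// leNgt blkW_gt0.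
Qed.

(** The constant value on [blk i] of the combination of the first [N] normalized blocks. *)
Definition step_coef N a i : R := if (i < N)%N then a i / nrm i else 0.

Lemma lincomb_step N a t : pos t ->
  lincomb (nblock W p k) N a t = step_coef N a (idx t).
Proof.
move=> pt; rewrite /lincomb /step_coef.
under eq_bigr => j _ do rewrite /nblock block_step//.
case: ifPn => [iN|]; last first.
  rewrite -leqNgt => Ni; rewrite big1// => j _.
  by rewrite gtn_eqF ?mul0r ?mulr0// (leq_trans (ltn_ord j)).
rewrite (bigD1 (Ordinal iN))//= eqxx mul1r big1 ?addr0// => j ji.
case: eqVneq => [ij|]; last by rewrite mul0r mulr0.
by case/eqP: ji; apply: val_inj; rewrite /= ij.
Qed.

(** The weighted moment is the sum of the |a j|^p times the ratios [blkW j / nrm j ^ p], which lie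
    between [D^-1] and 1 by [nrm_bounds]. The lower bound compares [Gsup] with the moment through
    the identity map, the upper one through [Gsup_step_le]. *)
Lemma Gsup_lincomb N a :
  ((D^-1 * \sum_(j < N) `|a j| `^ p)%:E <=
     Gsup W p (lincomb (nblock W p k) N a))%E /\
  (Gsup W p (lincomb (nblock W p k) N a) <=
     (D * \sum_(j < N) `|a j| `^ p)%:E)%E.
Proof.
have D0 : 0 < D by rewrite (lt_le_trans _ D1).
have -> : Gsup W p (lincomb (nblock W p k) N a) =
    Gsup W p (fun t => step_coef N a (idx t)).
  by apply: eq_Gsup => t; exact: lincomb_step.
have wE : wmoment lam W p pos (fun t : LType R => step_coef N a (idx t)) =
    (\sum_(j < N) `|step_coef N a j| `^ p * blkW j)%:E.
  apply: wmoment_blk_step_fin => j Nj.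
  by rewrite /step_coef ltnNge Nj.
have termE (j : 'I_N) : `|step_coef N a j| `^ p * blkW j =
    `|a j| `^ p * (blkW j / nrm j `^ p).
  rewrite /step_coef ltn_ord normrM normfV (gtr0_norm (nrm_gt0 _)) powRM//.
    by rewrite -powR_inv1 ?powR_ge0// -[_^-1 in LHS]powR_inv1 ?(ltW (nrm_gt0 _))//
      powRAC; ring.
  by rewrite invr_ge0 ltW// nrm_gt0.
have np0 j : 0 < nrm j `^ p by rewrite powR_gt0// nrm_gt0.
split.
  apply: le_trans (wmoment_le_Gsup _ _ _); rewrite wE lee_fin mulr_sumr.
  apply: ler_sum => j _; rewrite termE mulrC ler_wpM2l ?powR_ge0//.
  rewrite ler_pdivlMr// mulrC ler_pdivrMr// mulrC.
  by have /andP[] := nrm_bounds j.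
apply: (le_trans (Gsup_step_le _)); rewrite wE -EFinM lee_fin ler_pM2l//.
apply: ler_sum => j _; rewrite termE ler_piMr ?powR_ge0//.
by rewrite ler_pdivrMr// mul1r; have /andP[] := nrm_bounds j.
Qed.

Lemma lp_norm_powR N a : lp_norm p N a `^ p = \sum_(j < N) `|a j| `^ p.
Proof. by rewrite powRKV// sumr_ge0// => j _; rewrite powR_ge0. Qed.

Lemma blocks_equiv_lp : equiv_lp W p (D ^+ 2) (nblock W p k).
Proof.
have D0 : 0 < D by rewrite (lt_le_trans _ D1).
(* The [p]-th powers agree up to [D], so the norms agree up to D^(1/p), which is at most [D] because
   [p] and [D] are at least 1. *)
exists D, D; split => // N a.
have l0 : 0 <= lp_norm p N a by rewrite powR_ge0.
have S0 : 0 <= \sum_(j < N) `|a j| `^ p.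
  by rewrite sumr_ge0// => j _; rewrite powR_ge0.
have [lo hi] := Gsup_lincomb N a; split.
  apply: (Gnorm_ge p0); first by rewrite mulr_ge0// invr_ge0 ltW.
  apply: le_trans lo; rewrite powRM ?invr_ge0 ?(ltW D0)// lp_norm_powR lee_fin.
  by rewrite ler_wpM2r// ge1r_powR// invr_gt0 D0 invf_le1.
apply: (Gnorm_le p0 W0); first by rewrite mulr_ge0// ltW.
apply: (le_trans hi); rewrite powRM ?(ltW D0)// lp_norm_powR lee_fin.
by rewrite ler_wpM2r// le1r_powR.
Qed.

Lemma wmoment_average_le f : measurable_fun (pos : set (LType R)) f ->
  (wmoment lam W p pos f < +oo)%E ->
  (wmoment lam W p pos (P f) <= wmoment lam W p pos f)%E.
Proof.
rewrite -bigcup_blk => mf fi; apply: wmoment_block_average => //.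
- exact: measurable_blk.
- exact: trivIset_blk.
- exact: measurable_weight.
- exact: blk_weight_gt0.
- exact: blk_integrable.
- exact: blkW_gt0.
Qed.

Lemma inG_wmoment f : inG W p f -> (wmoment lam W p pos f < +oo)%E.
Proof.
by move=> [_]; rewrite Gnorm_lty//; apply: le_lt_trans; exact: wmoment_le_Gsup.
Qed.

(** The average is constant on blocks even though [f] is arbitrary, so [Gsup_step_le] applies to it;
    Jensen then replaces its moment by that of [f]. *)
Lemma Gsup_average_le f : inG W p f ->
  (Gsup W p (P f) <= D%:E * wmoment lam W p pos f)%E.
Proof.
move=> Gf; apply: le_trans (Gsup_step_le (fun j => waverage lam W (blk j) f)) _.
apply: lee_wpmul2l; first by rewrite lee_fin (le_trans _ D1).
by apply: wmoment_average_le; [case: Gf|exact: inG_wmoment].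
Qed.

Lemma inG_average f : inG W p f -> inG W p (P f).
Proof.
move=> Gf; split.
  exact: (measurable_blk_step (fun j => waverage lam W (blk j) f)).
rewrite Gnorm_lty//; apply: le_lt_trans (Gsup_average_le Gf) _.
by rewrite lte_mul_pinfty ?lee_fin ?(le_trans _ D1) ?wmoment_nonneg ?inG_wmoment.
Qed.

(** Cutting [P f] after [N] blocks leaves a step function whose [Gsup] is at most [D] times the tail
    of a convergent series. *)
Lemma average_cspan f : inG W p f -> cspan W p (nblock W p k) (P f).
Proof.
move=> Gf; split; first exact: inG_average.
move=> d d0; have D0 : 0 < D by rewrite (lt_le_trans _ D1).
pose c j := waverage lam W (blk j) f.
have t0 j : (0 <= (`|c j| `^ p * blkW j)%:E)%E.
  by rewrite lee_fin mulr_ge0 ?powR_ge0// ltW// blkW_gt0.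
have fin : (\sum_(j <oo) (`|c j| `^ p * blkW j)%:E < +oo)%E.
  rewrite -(wmoment_blk_step c); apply: le_lt_trans (inG_wmoment Gf).
  by apply: wmoment_average_le; [case: Gf|exact: inG_wmoment].
have dp0 : 0 < d `^ p / D by rewrite divr_gt0// powR_gt0.
have /= [N _ HN] := nneseries_tail_cvg fin (fun j _ => t0 j)
  (nbhs_open_ereal_lt (f := fun=> d `^ p / D) dp0).
(* The factor [nrm j] undoes the normalization, so the combination equals [P f] on the first [N]
   blocks. *)
exists N, (fun j => c j * nrm j); apply: (Gnorm_lt p0 W0) => //.
pose c' j := if (j < N)%N then 0 else c j.
rewrite (@eq_Gsup _ _ _ _ (fun t => c' (idx t))); last first.
  move=> t pt; rewrite lincomb_step// /step_coef /c' -/(c _); case: ifPn => _.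
    by rewrite mulfK ?subrr// gt_eqF// nrm_gt0.
  by rewrite subr0.
apply: le_lt_trans (Gsup_step_le c') _; rewrite wmoment_blk_step.
rewrite (nneseries_split 0 N); last first.
  by move=> j _; rewrite lee_fin mulr_ge0 ?powR_ge0// ltW// blkW_gt0.
rewrite add0n big_mkord big1 ?add0e => [|j _]; last first.
  by rewrite /c' ltn_ord normr0 powR0 ?mul0r// gt_eqF.
rewrite (_ : (\sum_(N <= j <oo) _)%E =
    (\sum_(N <= j <oo) (`|c j| `^ p * blkW j)%:E)%E); last first.
  rewrite eseries_cond [RHS]eseries_cond; apply: eq_eseriesr => j.
  by rewrite /c' ltnNge => /andP[_ ->].
by rewrite muleC -lte_pdivlMr//; exact: (HN N (leqnn N)).
Qed.

Lemma average_lin f g (x y : R) t : pos t -> inG W p f -> inG W p g ->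
  P (fun t => x * f t + y * g t) t = x * P f t + y * P g t.
Proof.
move=> pt Gf Gg; apply: (@block_average_lin _ _ _ lam W p blk); rewrite ?bigcup_blk//.
- exact: measurable_blk.
- exact: trivIset_blk.
- by rewrite -bigcup_blk; exact: measurable_weight.
- exact: blk_integrable.
- by case: Gf.
- exact: inG_wmoment.
- by case: Gg.
- exact: inG_wmoment.
Qed.

Lemma eq_average f g t : pos t -> (forall u, pos u -> f u = g u) -> P f t = P g t.
Proof.
move=> /pos_blk[j jt] fg; rewrite /block_average (block_indexE trivIset_blk jt).
rewrite /waverage; congr (_ / _); apply: eq_Rintegral => u; rewrite inE => ju.
by rewrite fg//; exact: (@blk_pos j).
Qed.

Lemma average_step c t : pos t -> P (fun t => c (idx t)) t = c (idx t).
Proof.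
move=> pt; apply: block_average_step; rewrite ?bigcup_blk//.
- exact: measurable_blk.
- exact: trivIset_blk.
- exact: blk_integrable.
- exact: blkW_gt0.
Qed.

(** Write f = g + h with [g] a finite combination of blocks and [h] small. Since [P] fixes [g], the
    difference P f - f equals P h - h, whose moment is small because averaging is contractive. A
    zero moment forces equality a.e., the weight being positive. *)
Lemma average_fixes_cspan f : cspan W p (nblock W p k) f -> Defs.ae_eq (P f) f.
Proof.
move=> [Gf approx].
have mpos : measurable (pos : set (LType R)) by exact: Lmeasurable_itv.
have mW : measurable_fun (pos : set (LType R)) (W : LType R -> R).
  by rewrite -bigcup_blk; exact: measurable_weight.
have mf : measurable_fun (pos : set (LType R)) f by case: Gf.
have mPf : measurable_fun (pos : set (LType R)) (P f).
  by case: (inG_average Gf).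
pose e t : R := P f t - f t.
have me : measurable_fun (pos : set (LType R)) (e : LType R -> R).
  exact: measurable_funB.
suff e0 : wmoment lam W p pos (e : LType R -> R) = 0%E.
  have := wmoment_eq0_ae mpos mW W0 me e0.
  by apply: filterS => t et pt; apply/eqP; rewrite -subr_eq0; apply/eqP; exact: et.
apply/eqP; rewrite eq_le; apply/andP; split; last exact: wmoment_nonneg.
apply/lee_addgt0Pr => r r0.
(* [P h] and [- h] each have moment at most [d ^ p], and [le_wmomentD] multiplies their sum by 2^p,
   which gives exactly [r]. *)
rewrite add0e; pose d := (r / (2 `^ p * 2)) `^ p^-1.
have q0 : 0 < r / (2 `^ p * 2) by rewrite divr_gt0// mulr_gt0// powR_gt0.
have d0 : 0 < d by rewrite powR_gt0.
have [N [a /(Gsup_lt p0 (ltW d0)) Hd]] := approx d d0.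
rewrite powRKV ?(ltW q0)// in Hd.
set h : LType R -> R := (fun t => _) in Hd.
pose g : LType R -> R := fun t => step_coef N a (idx t).
have hE t : pos t -> h t = f t - g t by move=> pt; rewrite /h lincomb_step.
have mg : measurable_fun (pos : set (LType R)) g by exact: measurable_blk_step.
have mh : measurable_fun (pos : set (LType R)) h.
  apply: (eq_measurable_fun (f \- g)); last exact: measurable_funB.
  by move=> t; rewrite inE => pt; rewrite hE.
have Gh : inG W p h by split => //; rewrite Gnorm_lty// (lt_trans Hd)// ltry.
have Lh : (wmoment lam W p pos h <= (r / (2 `^ p * 2))%:E)%E.
  exact: le_trans (wmoment_le_Gsup _ _ _) (ltW Hd).
have LPh := wmoment_average_le mh (inG_wmoment Gh).
have mPh : measurable_fun (pos : set (LType R)) (P h).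
  by case: (inG_average Gh).
have eE t : pos t -> e t = P h t + - h t.
  move=> pt; have := average_lin 1 (-1) pt Gf Gh.
  rewrite (@eq_average _ g) => [|//|u pu]; last by rewrite hE//; ring.
  by rewrite average_step// -/(g t) => gE; rewrite /e hE// gE; ring.
have -> : wmoment lam W p pos (e : LType R -> R) =
    wmoment lam W p pos (fun t => P h t + - h t).
  by apply: eq_integral => t; rewrite inE => pt; rewrite eE.
have mNh : measurable_fun (pos : set (LType R)) (fun t => - h t).
  exact: measurable_funN.
have H := le_wmomentD lam mpos mW W0 p1 mPh mNh; apply: le_trans H _.
have -> : wmoment lam W p pos (fun t => - h t) = wmoment lam W p pos h.
  by apply: eq_integral => t _; rewrite normrN.
apply: (@le_trans _ _ ((2 `^ p)%:E * ((r / (2 `^ p * 2))%:E +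
    (r / (2 `^ p * 2))%:E))%E).
  apply: lee_wpmul2l; first by rewrite lee_fin powR_ge0.
  by apply: leeD; [exact: le_trans LPh Lh|exact: Lh].
rewrite -EFinD -EFinM lee_fin le_eqVlt; apply/orP; left; apply/eqP; field.
by rewrite gt_eqF// powR_gt0.
Qed.

Lemma blocks_complemented (X : (R -> R) -> Prop) : D <= 2 ->
  (forall f, X f -> inG W p f) ->
  complemented W p 2 (cspan W p (nblock W p k)) X.
Proof.
move=> D2 XG; exists P; split.
- by move=> f /XG; exact: average_cspan.
- move=> f g x y /XG Gf /XG Gg; apply: aeW => t pt; exact: average_lin.
- exact: average_fixes_cspan.
- move=> f /XG Gf; apply: (Gnorm_le_mul p0 W0) => //.
  apply: (le_trans (Gsup_average_le Gf)).
  apply: lee_pmul; rewrite ?lee_fin ?(le_trans _ D1) ?wmoment_nonneg//.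
    (* Norm constant 2 allows a factor 2^p for [Gsup], and D <= 2 <= 2^p. *)
    by rewrite (le_trans D2)// le1r_powR// ler1n.
  exact: wmoment_le_Gsup.
Qed.

End consecutive_blocks.

(** * Choice of the blocks and conclusion *)

Lemma exists_dominated_blocks {R : realType} (W : R -> R) (D : R) :
  Wclass W -> 1 < D ->
  exists s : nat -> nat, [/\ s 0%N = 0%N, (forall j, (s j < s j.+1)%N) &
  forall j,
  (\int[lam]_(t in (`]0%R, (s j.+1 - s j)%:R]%classic : set (LType R))) (W t)%:E
   <= D%:E * \int[lam]_(t in blk s j) (W t)%:E)%E].
Proof.
move=> WW D1.
have /choice[l Hl] (n : nat) : exists l : nat, (0 < l)%N /\
    (\int[lam]_(t in (`]0%R, l%:R]%classic : set (LType R))) (W t)%:E <=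
     D%:E * \int[lam]_(t in (`]n%:R, (n + l)%:R]%classic : set (LType R)))
            (W t)%:E)%E.
  by have [l l0 Hl] := late_interval_dominates WW n D1; exists l.
(* A block starting at [m] receives the length [l m] that [late_interval_dominates] provides for
   that starting point. *)
pose s n := iter n (fun m => m + l m)%N 0%N.
exists s; split => // j; first by rewrite /s/= -addn1 leq_add2l (Hl _).1.
by rewrite /blk [s j.+1]/= addKn; exact: (Hl _).2.
Qed.

Theorem mainTheorem10 (R : realType) (p : R) (W : R -> R) :
  1 <= p -> Wclass W ->
  forall eps : R, 0 < eps ->
  exists k : nat -> nat,
    [/\ k 0%N = 1%N,
        (forall j, (k j < k j.+1)%N),
        equiv_lp W p (1 + eps) (nblock W p k) &
        complemented W p 2 (cspan W p (nblock W p k))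
                           (cspan W p (fun i => ind i.+1))].
Proof.
move=> p1 WW eps eps0.
(* The bound 2 serves the norm of the projection, the square root the equivalence constant
   [D ^+ 2]. *)
pose D := Num.min 2 (Num.sqrt (1 + eps)).
have D1 : 1 < D.
  by rewrite lt_min ltr1n/= -[ltLHS]sqrtr1 ltr_sqrt ?ltrDl// addr_gt0.
have DD : D ^+ 2 <= 1 + eps.
  rewrite -[leRHS]sqr_sqrtr ?addr_ge0 ?(ltW eps0)//.
  by rewrite ler_sqr ?nnegrE ?sqrtr_ge0 ?(ltW (lt_trans _ D1))// ge_min lexx orbT.
have [s [s0 sS dom]] := exists_dominated_blocks WW D1.
exists (fun j => (s j).+1); split.
- by rewrite s0.
- by move=> j; rewrite ltnS.
- have [A [B [A0 B0 AB H]]] := blocks_equiv_lp WW p1 s0 sS (ltW D1) dom.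
  by exists A, B; split => //; exact: le_trans DD.
- apply: (blocks_complemented WW p1 s0 sS (ltW D1) dom).
    by rewrite ge_min lexx.
  by move=> f [].
Qed.
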